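(* Let $A=(a_{ij})\in\{0,1\}^{m\times N}$ be a $1$-identifiable matrix, and let $\mathbf{w}_1,\ldots,\mathbf{w}_N\in\mathbb{R}^d$ be pairwise distinct vectors. For $i\in[m]$ let $p_i=\{j\in[N]:a_{ij}=1\}$ and $\mathcal{W}_i=\{\mathbf{w}_j: j\in p_i\}$. For $j\in[N]$ let $\mathcal{G}_j=\{i\in[m]: j\in p_i\}$ and $\mathcal{B}_j=[m]\setminus\mathcal{G}_j$. Then the rule $$\psi: j\mapsto \bigcap_{g\in\mathcal{G}_j}\mathcal{W}_g\ \cap\ \bigcap_{b\in\mathcal{B}_j}\mathcal{W}_b^{c}$$ recovers $\mathbf{w}_j$, i.e. for every $j\in[N]$ the set on the right-hand side is the singleton $\{\mathbf{w}_j\}$.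
   Context: For a positive integer $n$, $[n]=\{1,\ldots,n\}$. A matrix $A$ is called $k$-identifiable if every set of $2k$ of its columns is linearly independent; so $1$-identifiable means that every two columns are linearly independent. Complements (and intersections over an empty index set) are taken in the set $\{\mathbf{w}_1,\ldots,\mathbf{w}_N\}$. *)

(* Defs.v *)
From HB Require Import structures.
From mathcomp Require Import all_boot all_order all_algebra.
From mathcomp Require Import boolp classical_sets reals.
Set Implicit Arguments.
Unset Strict Implicit.
Unset Printing Implicit Defensive.
Import GRing.Theory.
Local Open Scope ring_scope.
Local Open Scope classical_set_scope.

(* Sets of columns are given by sets S of column indices, so that a repeated
   column counts as a linearly dependent pair. *)
Definition identifiable (F : fieldType) (k m N : nat) (A : 'M[F]_(m, N)) :=
  forall S : {set 'I_N}, #|S| = (2 * k)%N -> free [seq col j A | j <- enum S].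

Definition zero_one (F : fieldType) (m N : nat) (A : 'M[F]_(m, N)) :=
  forall i j, A i j = 0 \/ A i j = 1.

(* Intersection relative to an ambient set X: it is X when I is empty. *)
Definition inter_in (T I : Type) (X : set T) (J : set I) (F : I -> set T) :
  set T := X `&` \bigcap_(i in J) F i.

Section Recovery.
Variables (F : fieldType) (m N d : nat).
Variables (A : 'M[F]_(m, N)) (w : 'I_N -> 'cV[F]_d).

Definition pool (i : 'I_m) : set 'I_N := [set j | A i j = 1].

Definition pool_vectors (i : 'I_m) : set 'cV[F]_d := w @` pool i.

Definition good (j : 'I_N) : set 'I_m := [set i | pool i j].

Definition bad (j : 'I_N) : set 'I_m := ~` good j.

(* Complements are taken in range w = {w_1, ..., w_N}. *)
Definition psi (j : 'I_N) : set 'cV[F]_d :=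
  inter_in (range w) (good j) pool_vectors
  `&` inter_in (range w) (bad j) (fun b => range w `\` pool_vectors b).

End Recovery.

(* Main.v *)
Require Import Defs.
From mathcomp Require Import all_boot all_order all_algebra.
From mathcomp Require Import boolp classical_sets reals.
Local Open Scope ring_scope.
Local Open Scope classical_set_scope.

(** Since [w] is injective, [psi A w j] consists of the [w k] such that [k] lies
    in exactly the same pools as [j] ([psiE]): the good pools of [j] force
    [A i k = 1] where [A i j = 1], and the bad ones forbid it elsewhere.
    For a 0-1 matrix this means that columns [j] and [k] coincide
    ([zero_one_eq_col]), and two equal columns at distinct indices would be a
    linearly dependent pair ([identifiable1_col_inj]), so [k = j]. *)

(** A free family has no repeated vector, so equal columns at distinct indices
    would contradict the freeness of the pair they form. *)
Lemma identifiable1_col_inj {F : fieldType} {m N : nat} {A : 'M[F]_(m, N)} :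
  identifiable 1 A -> injective (fun j => col j A).
Proof.
move=> hA j k ejk; case: (eqVneq j k) => // njk.
have cjk : #|[set j; k]%SET| = (2 * 1)%N by rewrite cards2 njk.
have /dinjectiveP inj := free_uniq (hA _ cjk).
by apply: inj => //; rewrite !inE eqxx ?orbT.
Qed.

Lemma zero_one_eq_col {F : fieldType} {m N : nat} {A : 'M[F]_(m, N)} {j k} :
  zero_one A -> (forall i, A i j = 1 <-> A i k = 1) -> col j A = col k A.
Proof.
move=> hA01 same; apply/colP => i; rewrite !mxE.
case: (hA01 i j) => [ej|ej]; last by rewrite ej (proj1 (same i) ej).
case: (hA01 i k) => [ek|ek]; first by rewrite ej ek.
by rewrite ek (proj2 (same i) ek).
Qed.

Lemma pool_vectorsE {F : fieldType} {m N d : nat} {A : 'M[F]_(m, N)}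
    {w : 'I_N -> 'cV[F]_d} {i k} :
  injective w -> pool_vectors A w i (w k) <-> A i k = 1.
Proof.
move=> hw; split=> [[l Ail /hw <-] //|Aik]; by exists k.
Qed.

Lemma psiE {F : fieldType} {m N d : nat} {A : 'M[F]_(m, N)}
    {w : 'I_N -> 'cV[F]_d} {j k} :
  injective w -> psi A w j (w k) <-> (forall i, A i j = 1 <-> A i k = 1).
Proof.
move=> hw; split=> [[[_ hg] [_ hb]] i|same].
  split=> [Aij|Aik]; first exact/(pool_vectorsE hw)/hg.
  apply: contrapT => nAij; have [_] := hb i nAij.
  by apply; apply/(pool_vectorsE hw).
split; split; try by exists k.
  by move=> i Aij; apply/(pool_vectorsE hw)/same.
move=> i nAij; split; first by exists k.
by move=> /(pool_vectorsE hw)/same.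
Qed.

Theorem theorem4p9 (R : realType) (m N d : nat) (A : 'M[R]_(m, N))
    (w : 'I_N -> 'cV[R]_d) (hA01 : zero_one A) (hA : identifiable 1 A)
    (hw : injective w) (j : 'I_N) :
  psi A w j = [set w j].
Proof.
apply/seteqP; split=> [v psiv|_ ->]; last exact/psiE.
have [[[k _ ek] _] _] := psiv; move: psiv; rewrite -ek => /(psiE hw) same.
by rewrite (identifiable1_col_inj hA _ _ (zero_one_eq_col hA01 same)).
Qed.
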